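(* Let $\Omega_{\mathbb{D}}$ be a non-empty set and let $d_{\mathbb{D}}^1$, $d_{\mathbb{D}}^2$ be two real-valued metrics on $\Omega_{\mathbb{D}}$ such that $(\Omega_{\mathbb{D}},d_{\mathbb{D}}^1)$ and $(\Omega_{\mathbb{D}},d_{\mathbb{D}}^2)$ are complete metric spaces. If $d_{\mathbb{D}}^1$ and $d_{\mathbb{D}}^2$ are equivalent metrics on $\Omega_{\mathbb{D}}$, then $(\Omega_{\mathbb{D}},d_{\mathbb{D}})$ is a complete $\mathbb{D}$-metric space, where $d_{\mathbb{D}}=d_{\mathbb{D}}^1e_1+d_{\mathbb{D}}^2e_2$.
   Context: $\mathbb{D}=\{a+bk:a,b\in\mathbb{R}\}$, $k^2=1$, $k\notin\mathbb{R}$, is the ring of hyperbolic numbers; $e_1=\frac12(1+k)$, $e_2=\frac12(1-k)$; every element is uniquely $\alpha e_1+\beta e_2$ with $\alpha,\beta\in\mathbb{R}$. $\le'$ is the componentwise order with respect to $(\alpha,\beta)$, and $x<'y$ means strict inequality in both components; $\epsilon>'0$ means both components of $\epsilon$ are positive. A $\mathbb{D}$-metric on a non-empty set $\Omega_{\mathbb{D}}$ is a map $d_{\mathbb{D}}:\Omega_{\mathbb{D}}\times\Omega_{\mathbb{D}}\to\mathbb{D}$ with $d_{\mathbb{D}}(x,y)\ge'0$, $d_{\mathbb{D}}(x,y)=0$ iff $x=y$, $d_{\mathbb{D}}(x,y)=d_{\mathbb{D}}(y,x)$ and $d_{\mathbb{D}}(x,z)\le'd_{\mathbb{D}}(x,y)+d_{\mathbb{D}}(y,z)$.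 A sequence $(x_n)$ converges to $x_0$ if for every $\epsilon>'0$ there is $m\in\mathbb{N}$ with $d_{\mathbb{D}}(x_n,x_0)<'\epsilon$ for all $n>m$; it is Cauchy if for every $\epsilon>'0$ there is $N$ with $d_{\mathbb{D}}(x_n,x_m)<'\epsilon$ for all $n,m>N$; the space is complete if every Cauchy sequence converges. Two real metrics on a set are equivalent if they induce the same topology (equivalently, the same convergent sequences with the same limits). *)

(* Defs.v *)
From HB Require Import structures.
From mathcomp Require Import all_boot all_order all_algebra.
From mathcomp Require Import all_classical all_reals all_analysis.
From mathcomp Require Import ring lra.

Set Implicit Arguments.
Unset Strict Implicit.
Unset Printing Implicit Defensive.

Import Order.TTheory GRing.Theory Num.Theory.

Local Open Scope classical_set_scope.
Local Open Scope ring_scope.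

(* [Hyperbolic a b] stands for [a + b k] with [k ^+ 2 = 1]. *)
Record hyperbolic (R : Type) : Type := Hyperbolic { hre : R; him : R }.

Section HyperbolicRing.
Variable R : realType.
Local Notation D := (hyperbolic R).
Implicit Types x y z : D.

Definition pair_of_hyperbolic z : R * R := (hre z, him z).
Definition hyperbolic_of_pair (p : R * R) : D := Hyperbolic p.1 p.2.

Lemma pair_of_hyperbolicK : cancel pair_of_hyperbolic hyperbolic_of_pair.
Proof. by case. Qed.

HB.instance Definition _ := Choice.copy D (can_type pair_of_hyperbolicK).

Definition hyp_zero : D := Hyperbolic 0 0.
Definition hyp_opp x : D := Hyperbolic (- hre x) (- him x).
Definition hyp_add x y : D := Hyperbolic (hre x + hre y) (him x + him y).

Fact hyp_addA : associative hyp_add.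
Proof. by move=> x y z; rewrite /hyp_add /= !addrA. Qed.
Fact hyp_addC : commutative hyp_add.
Proof. by move=> x y; rewrite /hyp_add addrC [him x + _]addrC. Qed.
Fact hyp_add0 : left_id hyp_zero hyp_add.
Proof. by case=> a b; rewrite /hyp_add /= !add0r. Qed.
Fact hyp_addN : left_inverse hyp_zero hyp_opp hyp_add.
Proof. by case=> a b; rewrite /hyp_add /= !addNr. Qed.

HB.instance Definition _ :=
  GRing.isZmodule.Build D hyp_addA hyp_addC hyp_add0 hyp_addN.

Definition hyp_one : D := Hyperbolic 1 0.
Definition hyp_mul x y : D :=
  Hyperbolic (hre x * hre y + him x * him y) (hre x * him y + him x * hre y).

Fact hyp_mulA : associative hyp_mul.
Proof. by move=> x y z; rewrite /hyp_mul /=; congr Hyperbolic; ring. Qed.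
Fact hyp_mulC : commutative hyp_mul.
Proof. by move=> x y; rewrite /hyp_mul /=; congr Hyperbolic; ring. Qed.
Fact hyp_mul1 : left_id hyp_one hyp_mul.
Proof. by case=> a b; rewrite /hyp_mul /=; congr Hyperbolic; ring. Qed.
Fact hyp_mulDl : left_distributive hyp_mul hyp_add.
Proof. by move=> x y z; rewrite /hyp_mul /hyp_add /=; congr Hyperbolic; ring. Qed.
Fact hyp_one_neq0 : hyp_one != hyp_zero.
Proof. by apply/eqP => -[] /eqP; rewrite oner_eq0. Qed.

HB.instance Definition _ := GRing.Zmodule_isComNzRing.Build D
  hyp_mulA hyp_mulC hyp_mul1 hyp_mulDl hyp_one_neq0.

Definition hyp_scale (a : R) z : D := Hyperbolic (a * hre z) (a * him z).

Fact hyp_scaleA a b z : hyp_scale a (hyp_scale b z) = hyp_scale (a * b) z.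
Proof. by rewrite /hyp_scale /= !mulrA. Qed.
Fact hyp_scale1 : left_id 1 hyp_scale.
Proof. by case=> a b; rewrite /hyp_scale /= !mul1r. Qed.
Fact hyp_scaleDr : right_distributive hyp_scale +%R.
Proof. by move=> a x y; congr Hyperbolic => /=; ring. Qed.
Fact hyp_scaleDl z : {morph hyp_scale^~ z : a b / a + b}.
Proof. by move=> a b; congr Hyperbolic => /=; ring. Qed.

HB.instance Definition _ := GRing.Zmodule_isLmodule.Build R D
  hyp_scaleA hyp_scale1 hyp_scaleDr hyp_scaleDl.

Fact hyp_scaleAl (a : R) x y : a *: (x * y) = (a *: x) * y.
Proof. by congr Hyperbolic => /=; ring. Qed.

HB.instance Definition _ := GRing.Lmodule_isLalgebra.Build R D hyp_scaleAl.
HB.instance Definition _ := GRing.Lalgebra_isComAlgebra.Build R D.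

Definition hyp_k : D := Hyperbolic 0 1.
Definition hyp_e1 : D := 2^-1 *: (1 + hyp_k).
Definition hyp_e2 : D := 2^-1 *: (1 - hyp_k).

(* The unique real [alpha], [beta] with [z = alpha *: hyp_e1 + beta *: hyp_e2];
   see [hyp_idempotentP]. *)
Definition hyp_alpha z : R := hre z + him z.
Definition hyp_beta z : R := hre z - him z.

(* [hyp_lt] is strict in both components, so it is not the strict order
   associated with the partial order [hyp_le]. *)
Definition hyp_le x y : Prop :=
  hyp_alpha x <= hyp_alpha y /\ hyp_beta x <= hyp_beta y.
Definition hyp_lt x y : Prop :=
  hyp_alpha x < hyp_alpha y /\ hyp_beta x < hyp_beta y.

Lemma hyperbolicE z : z = (hre z)%:A + (him z)%:A * hyp_k.
Proof. by case: z => a b; congr Hyperbolic => /=; ring. Qed.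

Lemma hyp_k_sqr : hyp_k ^+ 2 = 1.
Proof. by rewrite expr2; congr Hyperbolic => /=; ring. Qed.

Lemma hyp_idempotentP z (a b : R) :
  z = a *: hyp_e1 + b *: hyp_e2 <-> a = hyp_alpha z /\ b = hyp_beta z.
Proof.
rewrite /hyp_alpha /hyp_beta; split => [->|[-> ->]] /=; first by split; field.
by case: z => c d; congr Hyperbolic => /=; field.
Qed.

End HyperbolicRing.

Arguments hyp_e1 {R}.
Arguments hyp_e2 {R}.
Arguments hyp_k {R}.

Record is_metric (R : realType) (T : Type) (d : T -> T -> R) : Prop := IsMetric {
  metric_ge0 : forall x y, 0 <= d x y;
  metric_eq0 : forall x y, d x y = 0 <-> x = y;
  metric_symm : forall x y, d x y = d y x;
  metric_trian : forall x y z, d x z <= d x y + d y z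
}.

(* [T] with the topology and uniformity of [d]; an alias is needed since two
   metrics on the same type are considered at once. *)
Definition metric_space (R : realType) (T : Type) (d : T -> T -> R)
  (dm : is_metric d) : Type := T.

Section MetricSpace.
Variables (R : realType) (T : Type) (d : T -> T -> R) (dm : is_metric d).
Local Notation M := (metric_space dm).

HB.instance Definition _ := gen_eqMixin M.
HB.instance Definition _ := gen_choiceMixin M.

Let dxx (x : M) : d x x = 0. Proof. exact/(metric_eq0 dm). Qed.
Let d_eq (x y : M) : d x y = 0 -> x = y. Proof. by move/(metric_eq0 dm). Qed.
Let d_sym (x y : M) : d x y = d y x. Proof. exact: (metric_symm dm). Qed.
Let d_trian (y x z : M) : d x z <= d x y + d y z.
Proof. exact: (metric_trian dm). Qed.

HB.instance Definition _ := @isMetric.Build R M d dxx d_eq d_sym d_trian.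

End MetricSpace.

Definition equivalent_metrics (R : realType) (T : Type) (d1 d2 : T -> T -> R)
    (m1 : is_metric d1) (m2 : is_metric d2) : Prop :=
  forall U : set T, @open (metric_space m1) U <-> @open (metric_space m2) U.

(* Sequential completeness; the completeness of [completeType] is about
   arbitrary Cauchy filters. *)
Definition complete_metric (R : realType) (T : Type) (d : T -> T -> R)
    (dm : is_metric d) : Prop :=
  forall u : nat -> metric_space dm,
    cauchy (u @ \oo) -> exists l : metric_space dm, u @ \oo --> l.

Section DMetric.
Variables (R : realType) (T : Type) (d : T -> T -> hyperbolic R).

Record is_Dmetric : Prop := IsDmetric {
  Dmetric_ge0 : forall x y, hyp_le 0 (d x y);
  Dmetric_eq0 : forall x y, d x y = 0 <-> x = y;
  Dmetric_sym : forall x y, d x y = d y x;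
  Dmetric_trian : forall x y z, hyp_le (d x z) (d x y + d y z)
}.

Definition Dconverges (u : nat -> T) (x0 : T) : Prop :=
  forall eps : hyperbolic R, hyp_lt 0 eps ->
    exists m : nat, forall n : nat, (m < n)%N -> hyp_lt (d (u n) x0) eps.

Definition Dcauchy (u : nat -> T) : Prop :=
  forall eps : hyperbolic R, hyp_lt 0 eps ->
    exists N : nat, forall n m : nat, (N < n)%N -> (N < m)%N ->
      hyp_lt (d (u n) (u m)) eps.

Definition Dcomplete : Prop :=
  forall u : nat -> T, Dcauchy u -> exists x0 : T, Dconverges u x0.

End DMetric.

(* Main.v *)
(* In the idempotent basis, order, sums and hence the Cauchy condition and
   convergence are componentwise.  A Cauchy sequence for [d] is therefore
   Cauchy for [d1], so it converges for [d1] by completeness; since both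
   metrics have the same open sets, it converges for [d2] to the same point. *)
Require Import Defs.
From mathcomp Require Import all_boot all_order all_algebra.
From mathcomp Require Import all_classical all_reals all_analysis.

Import Order.TTheory GRing.Theory Num.Theory.

Local Open Scope ring_scope.

Lemma ball_metric_space (R : realType) (T : Type) (d : T -> T -> R)
    (dm : is_metric d) (x : metric_space dm) (e : R) :
  ball x e = [set y : metric_space dm | d x y < e]%classic.
Proof. by rewrite ballEmdist. Qed.

(** Bridges filter convergence and the epsilon-index form used by [Dconverges]. Library balls are
    centred at the limit, which is why symmetry of [d] enters. *)
Lemma metric_space_cvgP (R : realType) (T : Type) (d : T -> T -> R)
    (dm : is_metric d) (u : nat -> metric_space dm) (l : metric_space dm) :
  (u @ \oo --> l)%classic <->
  forall e, 0 < e -> exists N, forall n, (N <= n)%N -> d (u n) l < e.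
Proof.
rewrite cvg_ballP; split=> ul e /ul [N].
  move=> _ uN; exists N => n /uN.
  by rewrite /= ball_metric_space /= (metric_symm dm).
by move=> uN; exists N => // n /uN; rewrite /= ball_metric_space /= (metric_symm dm).
Qed.

Lemma metric_space_cauchy (R : realType) (T : Type) (d : T -> T -> R)
    (dm : is_metric d) (u : nat -> metric_space dm) :
  (forall e, 0 < e -> exists N, forall n m, (N <= n)%N -> (N <= m)%N ->
    d (u n) (u m) < e) ->
  cauchy (u @ \oo)%classic.
Proof.
(* [cauchyP] asks, for each [e], for some point whose [e]-ball contains a tail of the sequence; the
   term [u N] serves as centre. *)
move=> uc; apply/cauchyP => e /uc [N uN]; exists (u N), N => // n /= Nn.
by rewrite ball_metric_space; exact: uN.
Qed.

Lemma equivalent_metrics_cvg (R : realType) (T : Type) (d1 d2 : T -> T -> R)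
    (m1 : is_metric d1) (m2 : is_metric d2) (u : nat -> T) (l : T) :
  equivalent_metrics m1 m2 ->
  ((u : nat -> metric_space m1) @ \oo --> (l : metric_space m1))%classic ->
  ((u : nat -> metric_space m2) @ \oo --> (l : metric_space m2))%classic.
Proof.
(* A neighbourhood of [l] for [d2] contains an open [B] around [l]. As [B] is also open for [d1], it
   contains a tail of [u]. *)
move=> d12 ul A; rewrite nbhsE => -[B [Bo Bl] BA].
apply: (filterS (P := fun n => B (u n))) => [n /BA //|].
by apply: ul; apply: open_nbhs_nbhs; split => //; apply/d12.
Qed.

Section IdempotentComponents.
Variable R : realType.
Implicit Types (a b : R) (x y : hyperbolic R).

Lemma hyp_alpha_idempotent a b : hyp_alpha (a *: hyp_e1 + b *: hyp_e2) = a.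
Proof. by have /hyp_idempotentP[<- _] := erefl (a *: @hyp_e1 R + b *: hyp_e2). Qed.

Lemma hyp_beta_idempotent a b : hyp_beta (a *: hyp_e1 + b *: hyp_e2) = b.
Proof. by have /hyp_idempotentP[_ <-] := erefl (a *: @hyp_e1 R + b *: hyp_e2). Qed.

Lemma hyp_alpha0 : hyp_alpha (0 : hyperbolic R) = 0.
Proof. exact: addr0. Qed.

Lemma hyp_beta0 : hyp_beta (0 : hyperbolic R) = 0.
Proof. exact: subr0. Qed.

Lemma hyp_alphaD x y : hyp_alpha (x + y) = hyp_alpha x + hyp_alpha y.
Proof. exact: addrACA. Qed.

Lemma hyp_betaD x y : hyp_beta (x + y) = hyp_beta x + hyp_beta y.
Proof. by rewrite /hyp_beta /= opprD addrACA. Qed.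

End IdempotentComponents.

(* [hyp_alphaD], [hyp_betaD] must come last: they would break up the idempotent forms. *)
Definition hypE := (hyp_alpha_idempotent, hyp_beta_idempotent,
  hyp_alpha0, hyp_beta0, hyp_alphaD, hyp_betaD).

Lemma is_Dmetric_idempotent (R : realType) (T : Type) (d1 d2 : T -> T -> R) :
  is_metric d1 -> is_metric d2 ->
  is_Dmetric (fun x y => d1 x y *: hyp_e1 + d2 x y *: hyp_e2).
Proof.
move=> m1 m2; split => [x y|x y|x y|x y z].
- by split; rewrite !hypE; [exact: metric_ge0 m1 _ _|exact: metric_ge0 m2 _ _].
- split=> [d0|->].
    (* The [hyp_e1] coordinate of a vanishing distance is [d1 x y], so separation for [d1] gives
       [x = y]. *)
    by apply/(metric_eq0 m1); rewrite -(hyp_alpha_idempotent _ (d1 x y) (d2 x y))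
      d0 hyp_alpha0.
  by rewrite (metric_eq0 m1 y y).2 // (metric_eq0 m2 y y).2 // !scale0r addr0.
- by rewrite (metric_symm m1) (metric_symm m2).
- by split; rewrite !hypE; [exact: metric_trian m1 _ _ _|exact: metric_trian m2 _ _ _].
Qed.

Theorem theorem3p5 (R : realType) (T : Type) (T_nonempty : inhabited T)
    (d1 d2 : T -> T -> R) (m1 : is_metric d1) (m2 : is_metric d2)
    (c1 : complete_metric m1) (c2 : complete_metric m2)
    (d12 : equivalent_metrics m1 m2) :
  let d : T -> T -> hyperbolic R :=
    fun x y => d1 x y *: hyp_e1 + d2 x y *: hyp_e2 in
  is_Dmetric d /\ Dcomplete d.
Proof.
move=> d; split; first exact: is_Dmetric_idempotent.
move=> u du.
have [l ul1] : exists l : metric_space m1,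
    ((u : nat -> metric_space m1) @ \oo --> l)%classic.
  apply/c1/metric_space_cauchy => e e0.
  (* Taking [e] in both coordinates makes the tolerance positive for [hyp_lt]; its first coordinate
     is the bound wanted for [d1]. *)
  have [|N uN] := du (e *: hyp_e1 + e *: hyp_e2); first by split; rewrite !hypE.
  (* [Dcauchy] speaks of indices strictly beyond [N], hence the successor. *)
  by exists N.+1 => n m Nn /(uN n m Nn)[]; rewrite !hypE.
have /metric_space_cvgP ul2 := equivalent_metrics_cvg _ _ _ _ m1 m2 u l d12 ul1.
move/metric_space_cvgP in ul1.
(* The two coordinates of [eps] act as independent real tolerances, one for [d1] and one for [d2];
   the larger of the two indices works for both. *)
exists l => eps []; rewrite hyp_alpha0 hyp_beta0 => /ul1[N1 uN1] /ul2[N2 uN2].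
exists (maxn N1 N2) => n /ltnW; rewrite geq_max => /andP[/uN1 ? /uN2 ?].
by split; rewrite !hypE.
Qed.
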